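(* Let $h:\mathbb{R}^n\to\mathbb{R}$ be a differentiable function that is $\mu_h$-strongly convex with $L_h$-Lipschitz continuous gradient, and let $f:\mathbb{R}^n\to\mathbb{R}$ be a differentiable function that is $\mu_f$-strongly convex with $L_f$-Lipschitz continuous gradient, where $\mu_h, L_h, \mu_f, L_f>0$. Let $\mathsf{D}_\theta:\mathbb{R}^n\to\mathbb{R}^n$ be an $M$-Lipschitz operator, with $M>0$. Suppose that $$M < \frac{\mu_h\,(\mu_f+L_f)}{L_h\,L_f-\mu_h\,\mu_f}$$ and that the step size $\gamma>0$ satisfies $$\frac{\mu_h}{\mu_f}\left(\frac{L_h}{\mu_h}-\frac{1}{M}\right) < \gamma < \frac{\mu_h}{L_f}\left(1+\frac{1}{M}\right).$$ Then, for every initial point $\boldsymbol{x}^0\in\mathbb{R}^n$, the sequence $(\boldsymbol{x}^k)_{k\ge 0}$ generated by the iteration $$\boldsymbol{z}^{k}=\nabla h^\ast\big(\nabla h(\boldsymbol{x}^k)-\gamma\nabla f(\boldsymbol{x}^k)\big),\qquad \boldsymbol{x}^{k+1}=\mathsf{D}_\theta(\boldsymbol{z}^k)$$ converges to a fixed point of the map $\boldsymbol{x}\mapsto \mathsf{D}_\theta\big(\nabla h^\ast(\nabla h(\boldsymbol{x})-\gamma\nabla f(\boldsymbol{x}))\big)$.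
   Context: All norms are Euclidean on $\mathbb{R}^n$. A differentiable function $\varphi:\mathbb{R}^n\to\mathbb{R}$ is $\mu$-strongly convex if $\varphi-\frac{\mu}{2}\|\cdot\|_2^2$ is convex. An operator $T:\mathbb{R}^n\to\mathbb{R}^n$ is $M$-Lipschitz if $\|T(\boldsymbol{x})-T(\boldsymbol{y})\|_2\le M\|\boldsymbol{x}-\boldsymbol{y}\|_2$ for all $\boldsymbol{x},\boldsymbol{y}\in\mathbb{R}^n$. $h^\ast$ denotes the Fenchel conjugate of $h$, $h^\ast(\boldsymbol{u})=\sup_{\boldsymbol{x}\in\mathbb{R}^n}\{\boldsymbol{u}^{\mathsf T}\boldsymbol{x}-h(\boldsymbol{x})\}$; for $h$ as in the claim it is finite and differentiable on $\mathbb{R}^n$, so $\nabla h^\ast:\mathbb{R}^n\to\mathbb{R}^n$ is well defined. $\mathsf{D}_\theta$ is an arbitrary operator (in applications, a neural network with parameters $\theta$). *)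

(* Defs.v *)
From HB Require Import structures.
From mathcomp Require Import all_boot all_order all_algebra.
From mathcomp Require Import all_classical all_reals all_analysis.

Set Implicit Arguments.
Unset Strict Implicit.
Unset Printing Implicit Defensive.

Import Order.TTheory GRing.Theory Num.Theory.
Import numFieldNormedType.Exports.

Local Open Scope classical_set_scope.
Local Open Scope ring_scope.

Definition dotv (R : realType) (n : nat) (u v : 'rV[R]_n) : R :=
  \sum_(i < n) u 0 i * v 0 i.

(* The library norm [`|x|] on ['rV[R]_n] is the sup norm, hence a separate
   Euclidean norm; both induce the same topology and the same notion of
   differentiability. *)
Definition norm2 (R : realType) (n : nat) (x : 'rV[R]_n) : R :=
  Num.sqrt (dotv x x).

Definition grad (R : realType) (n : nat) (f : 'rV[R]_n -> R^o) (x : 'rV[R]_n) :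
    'rV[R]_n :=
  \row_(i < n) 'D_(delta_mx 0 i) f x.

Definition strongly_convex (R : realType) (n : nat) (mu : R)
    (f : 'rV[R]_n -> R) : Prop :=
  convex_function setT
    ((fun x => f x - mu / 2 * norm2 x ^+ 2) : convex_lmodType 'rV[R]_n -> R^o).

Definition lipschitz2 (R : realType) (n : nat) (M : R)
    (T : 'rV[R]_n -> 'rV[R]_n) : Prop :=
  forall x y, norm2 (T x - T y) <= M * norm2 (x - y).

Definition fenchel_conj (R : realType) (n : nat) (h : 'rV[R]_n -> R)
    (u : 'rV[R]_n) : \bar R :=
  ereal_sup [set (dotv u x - h x)%:E | x in [set: 'rV[R]_n]].

(* [fine] maps an infinite value to 0, so this is the gradient of the conjugate
   only when the conjugate is finite everywhere, e.g. for a strongly convex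
   differentiable [h]. *)
Definition grad_conj (R : realType) (n : nat) (h : 'rV[R]_n -> R) :
    'rV[R]_n -> 'rV[R]_n :=
  grad (fun u => fine (fenchel_conj h u)).

(* Main.v *)
(* The function g = h - gamma f lies between its linearisation plus
   (mu_h - gamma L_f)/2 |d|^2 and plus (L_h - gamma mu_f)/2 |d|^2; such a two-sided
   quadratic bound makes grad g Lipschitz with constant
   c = max(L_h - gamma mu_f, gamma L_f - mu_h), without second derivatives.  As
   grad h* is the inverse of grad h and mu_h^-1-Lipschitz, the iteration map is
   M c / mu_h-Lipschitz.  The two bounds on gamma say exactly that M c < mu_h, so
   that Banach's fixed point theorem applies. *)
Require Import Defs.
From HB Require Import structures.
From mathcomp Require Import all_boot all_order all_algebra.
From mathcomp Require Import all_classical all_reals all_analysis.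
From mathcomp Require Import ring lra.

Set Implicit Arguments.
Unset Strict Implicit.
Unset Printing Implicit Defensive.

Import Order.TTheory GRing.Theory Num.Theory.
Import numFieldNormedType.Exports.

Local Open Scope classical_set_scope.
Local Open Scope ring_scope.

(** * Euclidean inner product and norm, and comparison with the sup norm *)

Section euclidean.
Context {R : realType} {n : nat}.
Implicit Types (x y z u v : 'rV[R]_n) (a : R).

Lemma dotvC x y : dotv x y = dotv y x.
Proof. by apply: eq_bigr => i _; rewrite mulrC. Qed.

Lemma dotvDl x y z : dotv (x + y) z = dotv x z + dotv y z.
Proof. by rewrite -big_split; apply: eq_bigr => i _; rewrite mxE mulrDl. Qed.

Lemma dotvZl a x y : dotv (a *: x) y = a * dotv x y.
Proof. by rewrite /dotv mulr_sumr; apply: eq_bigr => i _; rewrite mxE mulrA. Qed.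

Lemma dotvNl x y : dotv (- x) y = - dotv x y.
Proof. by rewrite -scaleN1r dotvZl mulN1r. Qed.

Lemma dotvDr x y z : dotv x (y + z) = dotv x y + dotv x z.
Proof. by rewrite ![dotv x _]dotvC dotvDl. Qed.

Lemma dotvZr a x y : dotv x (a *: y) = a * dotv x y.
Proof. by rewrite ![dotv x _]dotvC dotvZl. Qed.

Lemma dotvNr x y : dotv x (- y) = - dotv x y.
Proof. by rewrite ![dotv x _]dotvC dotvNl. Qed.

Definition dotvE := (dotvDl, dotvDr, dotvNl, dotvNr, dotvZl, dotvZr).

Lemma dotv_ge0 x : 0 <= dotv x x.
Proof. by apply: sumr_ge0 => i _; rewrite -expr2 sqr_ge0. Qed.

Lemma norm2_ge0 x : 0 <= norm2 x.
Proof. exact: sqrtr_ge0. Qed.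

Lemma norm2_sqr x : norm2 x ^+ 2 = dotv x x.
Proof. by rewrite sqr_sqrtr // dotv_ge0. Qed.

Lemma coord_le_norm2 x i : `|x 0 i| <= norm2 x.
Proof.
rewrite -sqrtr_sqr ler_wsqrtr // /dotv (bigD1 i) //= -expr2 lerDl.
by apply: sumr_ge0 => j _; rewrite -expr2 sqr_ge0.
Qed.

Lemma norm2_eq0 x : norm2 x = 0 -> x = 0.
Proof.
move=> x0; apply/rowP => i; rewrite mxE; apply/eqP.
by rewrite -normr_le0 -x0 coord_le_norm2.
Qed.

(** With [norm2_le], this carries estimates between [norm2] and the sup norm that defines
    convergence. *)
Lemma norm_le_norm2 x : `|x| <= norm2 x.
Proof.
rewrite [leLHS]/Num.norm/= mx_normrE; apply/bigmax_leP; split; first exact: norm2_ge0.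
by case=> i j _ /=; rewrite ord1 coord_le_norm2.
Qed.

Lemma norm2_le x : norm2 x ^+ 2 <= n%:R * `|x| ^+ 2.
Proof.
have -> : n%:R * `|x| ^+ 2 = \sum_(i < n) `|x| ^+ 2.
  by rewrite sumr_const card_ord mulr_natl.
rewrite norm2_sqr /dotv.
apply: ler_sum => i _; rewrite -expr2 -real_normK ?num_real // lerXn2r ?nnegrE//.
rewrite [leRHS]/Num.norm/= mx_normrE.
exact: (le_bigmax _ (fun ij : 'I_1 * 'I_n => `|x ij.1 ij.2|) (0, i)).
Qed.

(** Cauchy-Schwarz: expand the squared length of |y| x - |x| y, which is nonnegative, and divide by
    |x| |y|. *)
Lemma dotv_le_norm2 x y : dotv x y <= norm2 x * norm2 y.
Proof.
have [x0|x0] := eqVneq (norm2 x) 0.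
  by rewrite x0 (norm2_eq0 x0) -(scale0r 0) dotvZl !mul0r.
have [y0|y0] := eqVneq (norm2 y) 0.
  by rewrite y0 (norm2_eq0 y0) -(scale0r 0) dotvZr mul0r mulr0.
have xy_gt0 : 0 < norm2 x * norm2 y.
  by rewrite mulr_gt0 // lt_neqAle eq_sym ?x0 ?y0 norm2_ge0.
have := dotv_ge0 (norm2 y *: x - norm2 x *: y).
rewrite !dotvE -!norm2_sqr (dotvC y x) => H.
rewrite -(ler_pM2l xy_gt0); lra.
Qed.

Lemma norm2D_sqr x y : norm2 (x + y) ^+ 2 <= 2 * norm2 x ^+ 2 + 2 * norm2 y ^+ 2.
Proof.
rewrite !norm2_sqr; have := dotv_ge0 (x - y); rewrite !dotvE (dotvC y x); lra.
Qed.

End euclidean.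

(** Over a [realType] matrices are complete as well as normed; redeclaring the instance joins the
    two structures, as [normed_cvg] requires. *)
HB.instance Definition _ (R : realType) (m n : nat) :=
  NormedModule.on 'M[R]_(m, n).

(** * Convergence of Picard iterates of a Euclidean contraction *)

Section contraction.
Context {R : realType} {n : nat}.

(* Stated for [norm2], to which the library's Banach theorem, about the sup norm,
   does not apply. *)
Lemma lipschitz2_iter_cvg (q : R) (T : 'rV[R]_n -> 'rV[R]_n)
    (x : nat -> 'rV[R]_n) :
  0 <= q < 1 -> lipschitz2 q T -> (forall k, x k.+1 = T (x k)) -> cvgn x.
Proof.
move=> /andP[q_ge0 q_lt1] Tq xS.
pose C := norm2 (x 1%N - x 0%N).
have step k : norm2 (x k.+1 - x k) <= C * q ^+ k.
  elim: k => [|k IH]; first by rewrite expr0 mulr1.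
  rewrite xS [in x k.+1]xS (le_trans (Tq _ _)) // exprS mulrCA.
  by rewrite ler_wpM2l // -xS.
(* The increments are dominated by a geometric series, so their series converges absolutely. *)
have cx : cvgn (series (telescope x)).
  apply: normed_cvg; apply: (@series_le_cvg _ _ (geometric C q)) => k.
  - exact: normr_ge0.
  - by rewrite /geometric /= mulr_ge0 ?norm2_ge0 ?exprn_ge0.
  - by apply: le_trans (step k); exact: norm_le_norm2.
  by apply: is_cvg_geometric_series; rewrite ger0_norm.
have -> : x = (fun k => x 0%N + series (telescope x) k).
  by apply/funext => k; rewrite -eq_sum_telescope.
exact: is_cvgD (is_cvg_cst _) cx.
Qed.

(** Inserting T (x k) = x k.+1 between T l and the limit l bounds |T l - l|^2, which does not depend
    on k, by a quantity that tends to 0. *)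
Lemma lipschitz2_iter_cvg_fixed (q : R) (T : 'rV[R]_n -> 'rV[R]_n)
    (x : nat -> 'rV[R]_n) :
  0 <= q < 1 -> lipschitz2 q T -> (forall k, x k.+1 = T (x k)) ->
  exists2 xs, T xs = xs & x @ \oo --> xs.
Proof.
move=> q01 Tq xS; have cx := lipschitz2_iter_cvg q01 Tq xS.
exists (limn x) => //; set l := limn x.
have /andP[q_ge0 q_lt1] := q01.
have bound k : norm2 (T l - l) ^+ 2 <=
    2 * (n%:R * `|l - x k| ^+ 2) + 2 * (n%:R * `|l - x k.+1| ^+ 2).
  have -> : T l - l = (T l - T (x k)) + (x k.+1 - l) by rewrite xS subrKA.
  apply: (le_trans (norm2D_sqr _ _)); rewrite lerD // ler_pM2l //.
    apply: le_trans (norm2_le _).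
    rewrite lerXn2r ?nnegrE ?norm2_ge0 // (le_trans (Tq _ _)) //.
    by rewrite ler_piMl ?norm2_ge0 ?ltW.
  by rewrite (distrC l); exact: norm2_le.
have d0 : `|l - x k| @[k --> \oo] --> (0 : R).
  rewrite -(@normr0 _ 'rV[R]_n) -(subrr l).
  by apply: cvg_norm; apply: cvgB => //; exact: cvg_cst.
have d1 : `|l - x k.+1| @[k --> \oo] --> (0 : R).
  by rewrite (cvg_shiftS (fun k => `|l - x k|)).
have sq (u : nat -> R) : u @ \oo --> 0 -> 2 * (n%:R * u k ^+ 2) @[k --> \oo] --> 0.
  move=> u0; rewrite -(mulr0 2) -[X in 2 * X](mulr0 n%:R) -[X in n%:R * X](mulr0 0).
  apply: cvgM; first exact: cvg_cst; apply: cvgM; first exact: cvg_cst.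
  by rewrite (_ : (fun k => _) = (fun k => u k * u k)) //; apply: cvgM.
apply/eqP; rewrite -subr_eq0; apply/eqP/norm2_eq0.
apply/eqP; rewrite -sqrf_eq0 eq_le sqr_ge0 andbT.
have lim0 := cvgD (sq _ d0) (sq _ d1).
rewrite -[leRHS](addr0 0); apply: (cvgr_to_ge (lim0 _)).
by apply: nearW => k; exact: bound.
Qed.

End contraction.

(** * Two-sided quadratic bounds and Lipschitz gradients *)

Section quad_bounds.
Context {R : realType} {n : nat}.
Implicit Types (x y z u v d : 'rV[R]_n) (h f : 'rV[R]_n -> R).
Implicit Types (G F : 'rV[R]_n -> 'rV[R]_n).

(** [G] stands for the gradient, but no differentiability is asked, so the bounds combine linearly.
    The constant [a] may be negative: h - gamma f need not be convex. *)
Definition quad_bounds (a b : R) h G := forall x d,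
  a / 2 * dotv d d <= h (x + d) - h x - dotv (G x) d <= b / 2 * dotv d d.

Lemma derive_dotv_grad h x d :
  differentiable (h : 'rV[R]_n -> R^o) x ->
  'D_d (h : _ -> R^o) x = dotv (grad h x) d.
Proof.
move=> hx; rewrite deriveE // {1}(row_sum_delta d) linear_sum /=.
by apply: eq_bigr => i _; rewrite linearZ /= /grad mxE deriveE // mulrC.
Qed.

Lemma is_derive_line h x d (t : R) :
  (forall y, differentiable (h : 'rV[R]_n -> R^o) y) ->
  is_derive t 1 (fun s => h (x + s *: d) : R^o) (dotv (grad h (x + t *: d)) d).
Proof.
move=> hd.
have E : (fun s : R => s^-1 *: (((fun r : R => h (x + r *: d) : R^o) \o shift t)
            (s *: 1) - h (x + t *: d))) =
         (fun s : R => s^-1 *: (((h : _ -> R^o) \o shift (x + t *: d))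
            (s *: d) - h (x + t *: d))).
  apply/funext => s /=; congr (_ *: (h _ - _)).
  by rewrite [s *: 1]mulr1 scalerDl addrCA.
split; first by rewrite /derivable E; exact: diff_derivable.
by rewrite -derive_dotv_grad // /derive E.
Qed.

(** Descent lemma: [phi] is h along the segment minus the claimed quadratic majorant, up to a
    constant. Its derivative is nonpositive for t >= 0 by Cauchy-Schwarz, so the mean value theorem
    gives phi 1 <= phi 0. *)
Lemma lipschitz2_grad_upper (L : R) h x d :
  (forall y, differentiable (h : 'rV[R]_n -> R^o) y) ->
  lipschitz2 L (grad h) ->
  h (x + d) - h x - dotv (grad h x) d <= L / 2 * dotv d d.
Proof.
move=> hd hL.
pose phi t : R^o :=
  h (x + t *: d) - (dotv (grad h x) d * t + L / 2 * dotv d d * t ^+ 2).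
pose dphi t := dotv (grad h (x + t *: d)) d - dotv (grad h x) d - L * dotv d d * t.
have phiD t : is_derive (t : R) 1 phi (dphi t).
  have := is_derive_line x d t hd => ?.
  apply: is_derive_eq; rewrite /dphi /GRing.scale /=; lra.
have phiC : {within `[0, 1], continuous phi}.
  by apply: derivable_within_continuous => t _; have [] := phiD t.
have [c /[!in_itv]/= /andP[c_ge0 _]] := MVT_segment ler01 (fun t _ => phiD t) phiC.
rewrite /phi scale1r scale0r !addr0 subr0 mulr1 => phi01.
have : dotv (grad h (x + c *: d) - grad h x) d <= c * L * dotv d d.
  apply: (le_trans (dotv_le_norm2 _ _)).
  rewrite -norm2_sqr expr2 mulrA ler_wpM2r ?norm2_ge0 //.
  apply: (le_trans (hL _ _)); rewrite addrC addKr.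
  rewrite /norm2 dotvZl dotvZr mulrA -expr2 sqrtrM ?sqr_ge0 // sqrtr_sqr.
  by rewrite ger0_norm // mulrCA mulrA.
rewrite dotvDl dotvNl /dphi in phi01 *; lra.
Qed.

(** Convexity of h - mu/2 |.|^2 between x and x + d, divided by the weight t, bounds the difference
    quotient plus mu/2 |d|^2 (1 - t) by h (x + d) - h x; then t tends to 0 from the right. *)
Lemma strongly_convex_lower (mu : R) h x d :
  differentiable (h : 'rV[R]_n -> R^o) x -> strongly_convex mu h ->
  mu / 2 * dotv d d <= h (x + d) - h x - dotv (grad h x) d.
Proof.
move=> hx hc; rewrite lerBrDr -derive_dotv_grad //.
have cv : (t^-1 * (h (t *: d + x) - h x) + mu / 2 * dotv d d * (1 - t)) @[t --> 0^'+]
     --> ('D_d (h : _ -> R^o) x + mu / 2 * dotv d d * (1 - 0) : R).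
  apply: cvgD; first exact/cvg_dnbhs_at_right/diff_derivable.
  apply: cvgM; first exact: cvg_cst.
  by apply: cvgB; [exact: cvg_cst | exact: cvg_at_right_filter].
rewrite subr0 mulr1 in cv.
rewrite addrC; apply: (cvgr_to_le cv); near=> t.
have t_gt0 : 0 < t by [].
have t_le1 : t <= 1 by near: t; exact: nbhs_right_le.
rewrite -(ler_pM2l t_gt0) mulrDr mulVKf ?gt_eqF //.
have t01 : Itv.spec (@Itv.num_sem R) (Itv.Real `[0%Z, 1%Z]) t.
  by rewrite /= /Itv.num_sem /= in_itv /= num_real ltW.
have := hc (Itv.mk t01) (x + d) x; rewrite !in_setT => /(_ isT isT).
rewrite convRE /=.
have -> : conv (Itv.mk t01) (x + d : convex_lmodType _) x = t *: d + x :> 'rV[R]_n.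
  by rewrite /conv /=; apply/rowP => i; rewrite !mxE /unstable.onem /=; ring.
rewrite !norm2_sqr !dotvE (dotvC x d) /unstable.onem /=; lra.
Unshelve. all: by end_near. Qed.

Lemma grad_quad_bounds (mu L : R) h :
  (forall x, differentiable (h : 'rV[R]_n -> R^o) x) ->
  strongly_convex mu h -> lipschitz2 L (grad h) ->
  quad_bounds mu L h (grad h).
Proof.
move=> hd hc hL x d.
by rewrite strongly_convex_lower //= lipschitz2_grad_upper.
Qed.

Lemma quad_boundsB (t a b a' b' : R) h f G F : 0 <= t ->
  quad_bounds a b h G -> quad_bounds a' b' f F ->
  quad_bounds (a - t * b') (b - t * a')
    (fun x => h x - t * f x) (fun x => G x - t *: F x).
Proof.
move=> t_ge0 hG fF x d; move: (hG x d) (fF x d) => /andP[h1 h2] /andP[f1 f2].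
have := ler_wpM2l t_ge0 f1; have := ler_wpM2l t_ge0 f2.
rewrite !dotvE => ? ?; apply/andP; split; lra.
Qed.

(* Bound [h] at [x + e] and [y + e'], for two such common points symmetric about
   the midpoint of [x] and [y], from above at one end and from below at the other;
   in the sum the values of [h] cancel, and the shift [s] from the midpoint is
   optimised. *)
Lemma quad_bounds_lipschitz2 (c a b : R) h G : 0 < c -> - c <= a -> b <= c ->
  quad_bounds a b h G -> lipschitz2 c G.
Proof.
move=> c_gt0 ca bc hG x y.
pose d := x - y; pose q := G x - G y.
have up p e : h (p + e) - h p - dotv (G p) e <= c / 2 * dotv e e.
  have /andP[_ /le_trans] := hG p e; apply; rewrite ler_wpM2r ?dotv_ge0 //; lra.
have lo p e : - (c / 2 * dotv e e) <= h (p + e) - h p - dotv (G p) e.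
  have /andP[+ _] := hG p e; apply: le_trans; rewrite -mulNr ler_wpM2r ?dotv_ge0 //; lra.
have four_points m s : x - m = y + m ->
    2 * dotv (G x - G y) s <= c * (2 * dotv s s + 2 * dotv m m).
  move=> mE; have := up x (- m - s); have := lo y (m - s).
  have := up y (m + s); have := lo x (- m + s).
  rewrite !addrA mE !dotvE (dotvC s m); lra.
have mE : x - 2^-1 *: d = y + 2^-1 *: d.
  by rewrite /d; apply/rowP => i; rewrite !mxE; lra.
(* s = q / (2c) maximises 2 <q, s> - 2c |s|^2. With m = d / 2 the inequality becomes |q|^2 / c <=
   |q|^2 / (2c) + c |d|^2 / 2. *)
have := four_points _ ((2 * c)^-1 *: q) mE; rewrite !dotvZl !dotvZr -!norm2_sqr => H.
have {}H : norm2 q ^+ 2 <= (c * norm2 d) ^+ 2.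
  rewrite exprMn.
  have c0 : c != 0 by rewrite gt_eqF.
  have e1 : 2 * ((2 * c)^-1 * norm2 q ^+ 2) = c^-1 * norm2 q ^+ 2 by field.
  have e2 : c * (2 * ((2 * c)^-1 * ((2 * c)^-1 * norm2 q ^+ 2)) +
      2 * (2^-1 * (2^-1 * norm2 d ^+ 2))) = c^-1 * norm2 q ^+ 2 / 2
      + c * norm2 d ^+ 2 / 2.
    by field.
  move: H; rewrite e1 e2 => H.
  have {}H : c^-1 * norm2 q ^+ 2 <= c * norm2 d ^+ 2 by lra.
  by rewrite -(ler_pM2l (_ : 0 < c^-1)) ?invr_gt0 // expr2 -mulrA mulKf.
by rewrite -ler_sqr ?nnegrE ?mulr_ge0 ?norm2_ge0 // ltW.
Qed.

End quad_bounds.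

(** * The gradient of the conjugate as the Lipschitz inverse of the gradient *)

Section conjugate.
Context {R : realType} {n : nat} (mu L : R) (h : 'rV[R]_n -> R).
Context (G : 'rV[R]_n -> 'rV[R]_n).
Hypotheses (mu_gt0 : 0 < mu) (L_gt0 : 0 < L) (hG : quad_bounds mu L h G).
Implicit Types (x p u v d e : 'rV[R]_n).

(* [x - (G x - u) / L] is a contraction of [x] by the two-sided bounds for
   [|x|^2 / 2 - h / L]. *)
Lemma quad_bounds_surj u : exists p, G p = u.
Proof.
have sqP : quad_bounds 1 1 (fun x => dotv x x / 2) (@id 'rV[R]_n).
  by move=> x d; rewrite !dotvE (dotvC d x); apply/andP; split; lra.
have Linv_ge0 : 0 <= L^-1 by rewrite invr_ge0 ltW.
(* The entry 1/2 keeps [c] positive even when mu = L. *)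
pose c := Num.max (1 - L^-1 * mu) 2^-1.
have c_gt0 : 0 < c by rewrite lt_max invr_gt0 ltr0n orbT.
have c_lt1 : c < 1.
  by rewrite gt_max gtrBl mulr_gt0 ?invr_gt0 //= invf_lt1 // ltr1n.
have /(quad_bounds_lipschitz2 c_gt0) := quad_boundsB Linv_ge0 sqP hG.
rewrite mulVf ?gt_eqF // subrr oppr_le0 ltW // le_max lexx => /(_ isT isT) cL.
pose S x := x - L^-1 *: G x + L^-1 *: u.
have SL : lipschitz2 c S by move=> x y; rewrite /S opprD addrACA subrr addr0; exact: cL.
have c01 : 0 <= c < 1 by rewrite ltW.
have [p Sp _] := lipschitz2_iter_cvg_fixed
  (x := fun k => iter k S 0) c01 SL (fun=> erefl).
exists p; apply: (scalerI (lt0r_neq0 (_ : 0 < L^-1))); first by rewrite invr_gt0.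
move: Sp; rewrite /S -addrA => /(canRL (addKr p)).
by rewrite addNr addrC => /subr0_eq ->.
Qed.

(** Equality case of Fenchel-Young: the lower quadratic bound at p makes p a maximiser in the
    supremum. *)
Lemma fenchel_conj_grad p : fenchel_conj h (G p) = (dotv (G p) p - h p)%:E.
Proof.
apply/eqP; rewrite eq_le; apply/andP; split; last first.
  by apply: ereal_sup_ubound; exists p.
apply: ge_ereal_sup => _ [x _ <-]; rewrite lee_fin.
have /andP[+ _] := hG p (x - p); rewrite subrKC (dotvDr (G p)) dotvNr.
have : 0 <= mu / 2 * dotv (x - p) (x - p).
  by rewrite mulr_ge0 ?dotv_ge0 // divr_ge0 // ltW.
lra.
Qed.

(** By surjectivity G p + t e = G q for some q, so both conjugate values are explicit. The lower
    bounds at q and at p enclose their difference [A] between t <e, p> and t <e, p> + K t^2, so the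
    difference quotient tends to <e, p>. *)
Lemma grad_conjK p : grad_conj h (G p) = p.
Proof.
apply/rowP => i; rewrite /grad_conj /grad mxE /derive /=.
set e := delta_mx 0 i; apply: cvg_lim => //.
have -> : p 0 i = dotv e p.
  rewrite /dotv (bigD1 i) //= big1 ?addr0 => [|j ji]; first by rewrite !mxE !eqxx mul1r.
  by rewrite !mxE (negbTE ji) andbF mul0r.
pose K := dotv e e / (2 * mu).
have bound (t : R) : t != 0 ->
    `|dotv e p - t^-1 * (fine (fenchel_conj h (t *: e + G p)) -
                         fine (fenchel_conj h (G p)))| <= K * `|t|.
  move=> t0; have [q qE] := quad_bounds_surj (t *: e + G p).
  rewrite -qE !fenchel_conj_grad /= qE.
  have /andP[lo1 _] := hG p (q - p); have /andP[lo2 _] := hG q (p - q).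
  set A := _ - _ - (_ - _).
  have A_ge : t * dotv e p <= A.
    have : 0 <= mu / 2 * dotv (p - q) (p - q).
      by rewrite mulr_ge0 ?dotv_ge0 // divr_ge0 // ltW.
    move: lo2; rewrite subrKC qE /A !dotvE; lra.
  (* The bound at p leaves t <e, q - p> - mu/2 |q - p|^2 to estimate; completing the square gives at
     most t^2 |e|^2 / (2 mu), whence the value of [K]. *)
  have A_le : A <= t * dotv e p + K * t ^+ 2.
    have -> : K * t ^+ 2 = (2 * mu)^-1 * (t ^+ 2 * dotv e e) by rewrite /K; ring.
    have sq3 :
        0 <= (2 * mu)^-1 * dotv (mu *: (q - p) - t *: e) (mu *: (q - p) - t *: e).
      by rewrite mulr_ge0 ?dotv_ge0 // invr_ge0 mulr_ge0 // ltW.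
    have sqE : (2 * mu)^-1 * dotv (mu *: (q - p) - t *: e) (mu *: (q - p) - t *: e) =
      mu / 2 * dotv (q - p) (q - p) - t * dotv e (q - p)
      + (2 * mu)^-1 * (t ^+ 2 * dotv e e).
      rewrite !(dotvDl (mu *: (q - p))) !(dotvDr _ (mu *: (q - p))) !dotvNl !dotvNr.
      rewrite !dotvZl !dotvZr (dotvC (q - p) e); field; exact: lt0r_neq0.
    rewrite sqE in sq3.
    have eqp : dotv e (q - p) = dotv e q - dotv e p by rewrite dotvDr dotvNr.
    have Gqp : dotv (G p) (q - p) = dotv (G p) q - dotv (G p) p
      by rewrite dotvDr dotvNr.
    move: lo1 sq3; rewrite subrKC Gqp eqp /A (dotvDl (t *: e)) dotvZl; lra.
  have -> : dotv e p - t^-1 * A = t^-1 * (t * dotv e p - A).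
    by rewrite [RHS]mulrBr mulKf.
  rewrite normrM normfV ler_pdivrMl ?normr_gt0 // mulrCA -expr2 real_normK ?num_real //.
  by rewrite ler_norml; apply/andP; split; have := dotv_ge0 e; lra.
have K_ge0 : 0 <= K by rewrite divr_ge0 ?dotv_ge0 // mulr_ge0 // ltW.
have K1 : 0 < K + 1 by lra.
apply/cvgrPdist_le => eps eps_gt0; near=> t.
have t0 : t != 0 by near: t; exact: nbhs_dnbhs_neq.
apply: (le_trans (bound t t0)).
apply: (@le_trans _ _ ((K + 1) * `|t|)); first by rewrite ler_wpM2r //; lra.
rewrite -ler_pdivlMl //.
by near: t; apply: dnbhs0_le; rewrite mulr_gt0 // invr_gt0.
Unshelve. all: by end_near. Qed.

(** With u = G p and v = G q, adding the lower bounds at p and at q gives mu |p - q|^2 <= <G p - G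
    q, p - q>; Cauchy-Schwarz then allows division by |p - q|. *)
Lemma grad_conj_lipschitz2 : lipschitz2 mu^-1 (grad_conj h).
Proof.
move=> u v; have [[p <-] [q <-]] := (quad_bounds_surj u, quad_bounds_surj v).
rewrite !grad_conjK.
have /andP[lo1 _] := hG p (q - p); have /andP[lo2 _] := hG q (p - q).
have mono : mu * norm2 (p - q) ^+ 2 <= norm2 (G p - G q) * norm2 (p - q).
  apply: le_trans (dotv_le_norm2 _ _); rewrite norm2_sqr.
  by move: lo1 lo2; rewrite !subrKC !dotvE (dotvC q p); lra.
rewrite ler_pdivlMl //.
have [->|pq] := eqVneq (norm2 (p - q)) 0; first by rewrite mulr0 norm2_ge0.
by rewrite -(ler_pM2r (_ : 0 < norm2 (p - q))) ?lt0r ?pq ?norm2_ge0 // -mulrA -expr2.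
Qed.

End conjugate.

(** * Convergence of the iteration *)

Theorem theorem1 (R : realType) (n : nat)
    (h f : 'rV[R]_n -> R) (D : 'rV[R]_n -> 'rV[R]_n)
    (mu_h L_h mu_f L_f M gamma : R)
    (mu_h_gt0 : 0 < mu_h) (L_h_gt0 : 0 < L_h)
    (mu_f_gt0 : 0 < mu_f) (L_f_gt0 : 0 < L_f)
    (M_gt0 : 0 < M) (gamma_gt0 : 0 < gamma)
    (h_diff : forall x, differentiable (h : 'rV[R]_n -> R^o) x)
    (h_cvx : strongly_convex mu_h h)
    (h_lip : lipschitz2 L_h (grad h))
    (f_diff : forall x, differentiable (f : 'rV[R]_n -> R^o) x)
    (f_cvx : strongly_convex mu_f f)
    (f_lip : lipschitz2 L_f (grad f))
    (D_lip : lipschitz2 M D)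
    (M_lt : L_h * L_f - mu_h * mu_f != 0 ->
            M < mu_h * (mu_f + L_f) / (L_h * L_f - mu_h * mu_f))
    (gamma_gt : mu_h / mu_f * (L_h / mu_h - 1 / M) < gamma)
    (gamma_lt : gamma < mu_h / L_f * (1 + 1 / M)) :
  forall (x0 : 'rV[R]_n) (x z : nat -> 'rV[R]_n),
    x 0%N = x0 ->
    (forall k, z k = grad_conj h (grad h (x k) - gamma *: grad f (x k))) ->
    (forall k, x k.+1 = D (z k)) ->
    exists2 xs : 'rV[R]_n,
      D (grad_conj h (grad h xs - gamma *: grad f xs)) = xs
      & x @ \oo --> xs.
Proof.
move=> x0 x z _ zE xE.
have hQ := grad_quad_bounds h_diff h_cvx h_lip.
have fQ := grad_quad_bounds f_diff f_cvx f_lip.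
have gQ := quad_boundsB (ltW gamma_gt0) hQ fQ.
(* The first entry only serves to make [c] positive. *)
pose c := Num.max (mu_h / (2 * M))
  (Num.max (L_h - gamma * mu_f) (gamma * L_f - mu_h)).
have c_gt0 : 0 < c by rewrite lt_max divr_gt0 ?mulr_gt0.
(* The first entry contributes mu_h / 2; for the other two the claim is the lower and the upper
   bound on [gamma], with [mu_f] and [L_f] cleared. *)
have c_lt : M * c < mu_h.
  rewrite mulrC -ltr_pdivlMr // !gt_max; apply/and3P; split.
  - by rewrite ltr_pM2l // ltf_pV2 ?posrE ?mulr_gt0 // ltr_pMl // ltr1n.
  - move: gamma_gt; rewrite mulrAC ltr_pdivrMr // mulrBr mulrCA mulfV ?gt_eqF //.
    rewrite mulr1 mul1r; lra.
  - move: gamma_lt; rewrite mulrAC ltr_pdivlMr // mulrDr mul1r; lra.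
have gL : lipschitz2 c (fun y => grad h y - gamma *: grad f y).
  by apply: (quad_bounds_lipschitz2 c_gt0 _ _ gQ);
    rewrite 1?lerNl ?opprB /c !le_max lexx !orbT.
have M_ge0 := ltW M_gt0.
pose T y := D (grad_conj h (grad h y - gamma *: grad f y)).
have TL : lipschitz2 (M * (mu_h^-1 * c)) T.
  move=> y y'; rewrite -!mulrA (le_trans (D_lip _ _)) // ler_wpM2l //.
  apply: (le_trans (grad_conj_lipschitz2 mu_h_gt0 L_h_gt0 hQ _ _)).
  by rewrite ler_wpM2l ?invr_ge0 ?(ltW mu_h_gt0) //; exact: gL.
apply: (lipschitz2_iter_cvg_fixed _ TL) => [|k]; last by rewrite xE zE.
rewrite mulrCA mulr_ge0 ?invr_ge0 ?mulr_ge0 // ?ltW //=.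
by rewrite ltr_pdivrMl // mulr1.
Qed.
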